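(* Let $C$ be a non-empty finite subset of $\mathbb{Z}$ and let $X$ be a non-empty finite set of positive integers all of whose elements are $\ge\theta(C)$. Then the following procedure terminates and returns the minimal system of generators of ${\rm L}_C(X)$, the smallest $C$-incentive containing $X$: (1) $D=\emptyset$. (2) $Y={\rm msg}(\langle X\rangle)$. (3) $E=\{s+t : s,t\in Y\}\setminus D$. (4) $Z=Y\cup\bigcup_{e\in E}(\{e\}+C)$. (5) If ${\rm msg}(\langle Z\rangle)=Y$, then return $Y$. (6) Set $Y={\rm msg}(\langle Z\rangle)$, $D=D\cup E$, and go to (3).
   Context: $\mathbb{N}$ denotes the non-negative integers. For $C\subseteq\mathbb{Z}$, a $C$-incentive is a submonoid $M$ of $(\mathbb{N},+)$ such that $s+t+c\in M$ for all $s,t\in M\setminus\{0\}$ and all $c\in C$. For a non-empty finite $C\subseteq\mathbb{Z}$, $\theta(C)=-\min(C\cup\{0\})$. If some $C$-incentive contains $X$ (which is the case when $X\subseteq\{n\in\mathbb{N}: n\ge\theta(C)\}$), ${\rm L}_C(X)$ denotes the intersection of all $C$-incentives containing $X$. $\langle X\rangle$ denotes the submonoid of $(\mathbb{N},+)$ generated by $X$. For a submonoid $M$ of $(\mathbb{N},+)$, ${\rm msg}(M)=(M\setminus\{0\})\setminus((M\setminus\{0\})+(M\setminus\{0\}))$ is its unique minimal system of generators, which is finite. *)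

(* Defs.v *)
From HB Require Import structures.
From mathcomp Require Import all_boot all_order all_algebra.
From mathcomp Require Import finmap.
From mathcomp Require Import boolp classical_sets.

Set Implicit Arguments.
Unset Strict Implicit.
Unset Printing Implicit Defensive.

Import Order.TTheory GRing.Theory Num.Theory.

Local Open Scope classical_set_scope.
Local Open Scope ring_scope.

(* Subsets of N and Z that may be infinite (monoids, incentives) are classical
   sets; the finite sets given to, or handled by, the procedure are {fset _}. *)

Definition submonoid (M : set nat) : Prop :=
  M 0%N /\ forall s t, M s -> M t -> M (s + t)%N.

(* c may be negative, so s + t + c is formed in Z and then required to be (the
   image of) an element of M. *)
Definition incentive (C : {fset int}) (M : set nat) : Prop :=
  submonoid M /\
  forall s t c, (M `\ 0%N) s -> (M `\ 0%N) t -> c \in C ->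
    (Posz @` M) (s%:Z + t%:Z + c).

(* The initial value 0 of the iterated minimum is the 0 of C \cup {0}. *)
Definition theta (C : {fset int}) : int := - \big[Num.min/0]_(c <- C) c.

Definition monoid_gen (X : set nat) : set nat := smallest submonoid X.

(* Intersection of all C-incentives containing X. *)
Definition LC (C : {fset int}) (X : set nat) : set nat :=
  smallest (incentive C) X.

Definition msg (M : set nat) : set nat :=
  (M `\ 0%N) `\` [set (s + t)%N | s in M `\ 0%N & t in M `\ 0%N].

(* The procedure carries Y and D; new_sums is its E and enlarge its Z. *)
Definition new_sums (Y D : {fset nat}) : {fset nat} :=
  ([fset (s + t)%N | s in Y, t in Y] `\` D)%fset.

(* C may have negative elements, so Z is a priori only a set of integers. *)
Definition enlarge (C : {fset int}) (Y E : {fset nat}) : {fset int} :=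
  ([fset y%:Z | y in Y] `|` [fset (e%:Z + c)%R | e in E, c in C])%fset.

(* Y' = msg(<Z>), for the Z computed from Y and D. As <Z> is only meaningful for
   Z contained in N, the relation requires all elements of Z to be
   non-negative: the procedure would be stuck otherwise. *)
Definition next (C : {fset int}) (Y D Y' : {fset nat}) : Prop :=
  exists Z : {fset nat},
    [fset z%:Z | z in Z]%fset = enlarge C Y (new_sums Y D) /\
    [set` Y'] = msg (monoid_gen [set` Z]).

(* Big-step semantics: [loop C Y D R] holds when the execution entering the
   loop body with current values Y and D terminates and returns R. *)
Inductive loop (C : {fset int}) (Y D : {fset nat}) : {fset nat} -> Prop :=
| loop_return : next C Y D Y -> loop C Y D Y
| loop_again (Y' R : {fset nat}) :
    next C Y D Y' -> Y' <> Y ->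
    loop C Y' (D `|` new_sums Y D)%fset R -> loop C Y D R.

(* The whole procedure terminates on input C, X and returns R. *)
Definition returns (C : {fset int}) (X R : {fset nat}) : Prop :=
  exists Y : {fset nat},
    [set` Y] = msg (monoid_gen [set` X]) /\ loop C Y fset0 R.

Lemma set_fset_inj (A B : {fset nat}) : [set` A] = [set` B] -> A = B.
Proof.
move=> AB; apply/fsetP => x; apply/idP/idP => xA.
- by have : [set` A] x by []; rewrite AB.
- by have : [set` B] x by []; rewrite -AB.
Qed.

Lemma next_inj C Y D Y1 Y2 : next C Y D Y1 -> next C Y D Y2 -> Y1 = Y2.
Proof.
move=> [Z1 [e1 h1]] [Z2 [e2 h2]]; apply: set_fset_inj; rewrite h1 h2.
suff -> : Z1 = Z2 by [].
have mZ (Z : {fset nat}) x : (x \in Z) = (x%:Z \in [fset z%:Z | z in Z]%fset).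
  apply/idP/imfsetP => [xZ|[y /= yZ [->]] //]; by exists x.
by apply/fsetP => x; rewrite !mZ e1 e2.
Qed.

Lemma loop_inj C Y D R1 R2 : loop C Y D R1 -> loop C Y D R2 -> R1 = R2.
Proof.
move=> l1; elim: l1 R2 => {Y D R1} [Y D n1|Y D Y1 R1 n1 ne1 _ IH] R2 l2.
- case: l2 => [//|Y2 R n2 ne2 _]; by case: ne2; apply: next_inj n2 n1.
- case: l2 IH => [n2|Y2 R n2 ne2 l2] IH.
    by case: ne1; apply: next_inj n1 n2.
  by apply: IH; rewrite (next_inj n1 n2).
Qed.

(* The procedure is deterministic, so that [returns C X R] is indeed
   "the procedure terminates, and its result is R". *)
Lemma returns_inj C X R1 R2 : returns C X R1 -> returns C X R2 -> R1 = R2.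
Proof.
move=> [Y1 [h1 l1]] [Y2 [h2 l2]]; apply: loop_inj l1 _.
by rewrite (set_fset_inj (etrans h1 (esym h2))).
Qed.

Lemma theta_min (C : {fset int}) c : c \in C -> - c <= theta C.
Proof.
by move=> cC; rewrite lerN2; exact: (@ge_bigmin_seq _ _ _ _ _ _ xpredT id).
Qed.

Lemma incentive_theta (C : {fset int}) :
  incentive C [set n : nat | n = 0%N \/ theta C <= n%:Z].
Proof.
split=> [|s t c [hs0 s0] [ht0 t0] cC].
- split=> [|s t [->|hs] [->|ht]] /=; rewrite ?addn0 ?add0n; try by left.
  - by right.
  - by right.
  by right; rewrite PoszD (le_trans hs) // lerDl.
- have hs : theta C <= s%:Z by case: hs0 => // s00; case: s0.
  have ht : theta C <= t%:Z by case: ht0 => // t00; case: t0.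
  have le_s : s%:Z <= s%:Z + t%:Z + c.
    rewrite -addrA lerDl -lerBlDr add0r; exact: le_trans (theta_min cC) ht.
  have n0 : 0 <= s%:Z + t%:Z + c by exact: le_trans le_s.
  exists (absz (s%:Z + t%:Z + c)); last by rewrite gez0_abs.
  by right; rewrite /= gez0_abs // (le_trans hs).
Qed.

(* If X lies in {n | theta C <= n}, then LC C X is the smallest C-incentive
   containing X. *)
Lemma LC_smallest (C : {fset int}) (X : set nat) :
  (forall x, X x -> theta C <= x%:Z) ->
  [/\ incentive C (LC C X), X `<=` LC C X &
      forall M, incentive C M -> X `<=` M -> LC C X `<=` M].
Proof.
move=> Xth; split; last 2 first.
- exact: sub_gen_smallest.
- by move=> M; exact: smallest_sub.
split; first split.
- by move=> M [[[]]].
- move=> s t Ls Lt M MX; case: (MX) => [[[_ MD] _] _].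
  by apply: MD; [exact: Ls|exact: Lt].
- move=> s t c [Ls s0] [Lt t0] cC.
  have mem M : incentive C M -> X `<=` M -> (Posz @` M) (s%:Z + t%:Z + c).
    by move=> IM XM; case: (IM) => _; apply=> //; split=> //;
      [exact: Ls|exact: Lt].
  have XT : X `<=` [set n : nat | n = 0%N \/ theta C <= n%:Z].
    by move=> x /Xth; right.
  have [u _ uE] := mem _ (incentive_theta C) XT.
  exists u => // M [IM XM].
  by have [v Mv] := mem M IM XM; rewrite -uE => -[<-].
Qed.

(* Main.v *)
Require Import Defs.
From mathcomp Require Import all_boot all_order all_algebra.
From mathcomp Require Import finmap.
From mathcomp Require Import boolp classical_sets.
From mathcomp Require Import zify.
Set Implicit Arguments.
Unset Strict Implicit.
Unset Printing Implicit Defensive.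
Import Order.TTheory GRing.Theory Num.Theory.
Local Open Scope classical_set_scope.
Local Open Scope ring_scope.

(** The monoids <Y> met by the procedure increase and contain a fixed m > 0.
    A submonoid containing m is determined by the least element of each of its
    residue classes modulo m, so such a chain is stationary and the procedure
    stops.  All these monoids stay inside L_C(X).  When the procedure stops,
    s + t + c lies in <Y> for all generators s, t in Y and c in C: the sum s + t
    was treated either in the last round or in a previous one, and D records the
    latter.  Adding further generators shows that <Y> is a C-incentive. *)

(** * Submonoids of the naturals and their minimal generators *)

Lemma submonoid_muln (M : set nat) (m q : nat) :
  submonoid M -> M m -> M (q * m)%N.
Proof.
move=> [M0 MD] Mm; elim: q => [|q IH]; first by rewrite mul0n.
by rewrite mulSn; apply: MD.
Qed.

Lemma monoid_gen_submonoid (X : set nat) : submonoid (monoid_gen X).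
Proof.
split=> [M [[]] //|s t Xs Xt M MX].
by have [[_ MD] _] := MX; apply: MD; [exact: Xs|exact: Xt].
Qed.

Lemma sub_monoid_gen (X : set nat) : X `<=` monoid_gen X.
Proof. exact: sub_gen_smallest. Qed.

Lemma monoid_gen_sub (X M : set nat) :
  submonoid M -> X `<=` M -> monoid_gen X `<=` M.
Proof. exact: smallest_sub. Qed.

(** A sum of two nonzero elements of [monoid_gen X] is never in the [msg], so the elements
    satisfying the implication are closed under addition. *)
Lemma msg_monoid_gen_sub (X : set nat) : msg (monoid_gen X) `<=` X.
Proof.
have [G0 GD] := monoid_gen_submonoid X.
suff sub : monoid_gen X `<=`
    [set x | monoid_gen X x /\ (msg (monoid_gen X) x -> X x)].
  by move=> x mx; have [[Gx _] _] := mx; have [_] := sub x Gx; apply.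
apply: monoid_gen_sub => [|x Xx]; last by split=> //; exact: sub_monoid_gen.
split=> [|s t [Gs Xs] [Gt Xt]]; first by split=> // -[[_ /(_ erefl)]].
split; first exact: GD.
have [->|/eqP s0] := eqVneq s 0%N; first by rewrite add0n.
have [->|/eqP t0] := eqVneq t 0%N; first by rewrite addn0.
by case=> _ []; exists s; last exists t.
Qed.

(** Strong induction: a nonzero element outside [msg M] is a sum of two nonzero, hence smaller,
    elements of [M]. *)
Lemma monoid_gen_msg (M : set nat) : submonoid M -> monoid_gen (msg M) = M.
Proof.
move=> sM; apply/seteqP; split; first by apply: monoid_gen_sub => // x [[]].
have [G0 GD] := monoid_gen_submonoid (msg M).
elim/ltn_ind => x IH Mx.
have [->//|/eqP x0] := eqVneq x 0%N.
have [/sub_monoid_gen//|nx] := pselect (msg M x).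
have [[s [Ms s0] [t [Mt t0] xE]]|nst] :=
  pselect ([set (s + t)%N | s in M `\ 0%N & t in M `\ 0%N] x); last by case: nx.
rewrite /= in s0 t0.
by rewrite -xE; apply: GD; apply: IH => //; rewrite -xE; lia.
Qed.

(** Split one generator off each nonzero element: [s = y + z], [t = y' + z']. Then [s + t + c] is
    [y + y' + c] plus [z + z']. *)
Lemma monoid_gen_incentive (C : {fset int}) (Y : set nat) :
    (forall s t c, Y s -> Y t -> c \in C ->
       (Posz @` monoid_gen Y) (s%:Z + t%:Z + c)) ->
  incentive C (monoid_gen Y).
Proof.
move=> YC; have [G0 GD] := monoid_gen_submonoid Y.
split=> [//|s t c [Gs s0] [Gt t0] cC].
have split_gen : monoid_gen Y `<=`
    [set x | monoid_gen Y x /\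
       (x <> 0%N -> exists2 y, Y y & exists2 z, monoid_gen Y z & x = (y + z)%N)].
  apply: monoid_gen_sub => [|y Yy]; last first.
    split=> [|_]; first exact: sub_monoid_gen.
    by exists y => //; exists 0%N; rewrite ?addn0.
  split=> // a b [Ga Ha] [Gb Hb]; split; first exact: GD.
  have [->|/eqP a0] := eqVneq a 0%N; first by rewrite add0n.
  move=> _; have [y Yy [z Gz ->]] := Ha a0.
  by exists y => //; exists (z + b)%N; [exact: GD|rewrite addnA].
have [_ /(_ s0) [y Yy [z Gz ->]]] := split_gen s Gs.
have [_ /(_ t0) [y' Yy' [z' Gz' ->]]] := split_gen t Gt.
have [u Gu uE] := YC y y' c Yy Yy' cC.
by exists (u + (z + z'))%N; [do 2!apply: (GD) => //|lia].
Qed.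

(** * Increasing chains of submonoids *)

Lemma submonoid_chain_stationary (M : nat -> set nat) (m : nat) :
    (0 < m)%N -> (forall k, submonoid (M k)) -> (forall k, M k m) ->
    (forall k, M k `<=` M k.+1) ->
  exists K, forall k, M k `<=` M K.
Proof.
move=> m0 sM Mm incM.
have homM j k : (j <= k)%N -> M j `<=` M k.
  move=> /subnKC <-; elim: (k - j)%N => [|d IH]; first by rewrite addn0.
  by rewrite addnS; apply: subset_trans IH _.
(* The least element of class [r] met anywhere in the chain lies in some [M k]; adding multiples of
   [m] gives the rest of the class. *)
have class (r : 'I_m) :
    exists k, forall j x, M j x -> (x %% m)%N = r -> M k x.
  have [[x0 [j0 [Mx0 x0r]]]|nM] :=
      pselect (exists x, exists j, M j x /\ (x %% m)%N = r); last first.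
    (* A class that is never met imposes no condition: any index will do. *)
    by exists 0%N => j x Mx xr; case: nM; exists x, j.
  have exP : exists x, `[< exists j, M j x /\ (x %% m)%N = r >].
    by exists x0; apply/asboolP; exists j0.
  case: (ex_minnP exP) => n /asboolP [k [Mn nr]] nmin.
  exists k => j x Mx xr.
  have nx : (n <= x)%N by apply: nmin; apply/asboolP; exists j.
  have /dvdnP [q qE] : (m %| x - n)%N by rewrite -eqn_mod_dvd // xr nr.
  rewrite -(subnKC nx) qE; have [_ MD] := sM k.
  by apply: MD => //; apply: submonoid_muln.
have [f fP] := choice class.
exists (\max_(r < m) f r) => k x Mx.
have rm : (x %% m < m)%N by rewrite ltn_mod.
apply: (homM (f (Ordinal rm))); first exact: leq_bigmax.
exact: fP Mx _.
Qed.

(** * Rounds of the procedure *)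

Definition msg_fset (Z : {fset nat}) : {fset nat} :=
  [fset z in Z | `[< msg (monoid_gen [set` Z]) z >]]%fset.

Lemma msg_fsetE Z : [set` msg_fset Z] = msg (monoid_gen [set` Z]).
Proof.
apply/seteqP; split=> x /=; first by rewrite !inE => /andP[_ /asboolP].
move=> mx; rewrite !inE; apply/andP; split; last exact/asboolP.
exact: msg_monoid_gen_sub mx.
Qed.

Lemma monoid_gen_msg_fset (Z : {fset nat}) :
  monoid_gen [set` msg_fset Z] = monoid_gen [set` Z].
Proof. by rewrite msg_fsetE monoid_gen_msg //; exact: monoid_gen_submonoid. Qed.

(** During the run [enlarge] has no negative element, so [absz] loses nothing. *)
Definition enlarge_nat (C : {fset int}) (Y E : {fset nat}) : {fset nat} :=
  [fset absz z | z in enlarge C Y E]%fset.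

(** The pairs (Y, D) computed round after round, without the stopping test. *)
Definition run (C : {fset int}) (X : {fset nat}) (k : nat) :
    {fset nat} * {fset nat} :=
  iter k (fun YD => let E := new_sums YD.1 YD.2 in
            (msg_fset (enlarge_nat C YD.1 E), (YD.2 `|` E)%fset))
    (msg_fset X, fset0).

Section Run.
Variables (C : {fset int}) (X : {fset nat}).
Hypothesis X_theta : forall x : nat, x \in X -> theta C <= x%:Z.

Local Notation Y k := (run C X k).1.
Local Notation D k := (run C X k).2.
Local Notation E k := (new_sums (Y k) (D k)).
Local Notation Z k := (enlarge_nat C (Y k) (E k)).
Local Notation G k := (monoid_gen [set` Y k]).

Lemma enlargeP (A B : {fset nat}) z : z \in enlarge C A B <->
  (exists2 y, y \in A & z = y%:Z) \/
  exists e c, [/\ e \in B, c \in C & z = e%:Z + c].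
Proof.
rewrite inE; split=> [/orP[/imfsetP[y /= yA ->]|/imfset2P[e /= eB [c /= cC ->]]]|].
- by left; exists y.
- by right; exists e, c.
case=> [[y yA ->]|[e [c [eB cC ->]]]]; apply/orP.
- by left; apply/imfsetP; exists y.
- by right; apply/imfset2P; exists e => //; exists c.
Qed.

Lemma new_sumsP (A B : {fset nat}) e : e \in new_sums A B ->
  exists s t, [/\ s \in A, t \in A & e = (s + t)%N].
Proof.
by rewrite inE => /andP[_ /imfset2P[s /= sA [t /= tA ->]]]; exists s, t.
Qed.

(** Since [c >= - theta C], the summand [t >= theta C] absorbs [c], so [s + t + c >= s]. This keeps
    the procedure from getting stuck. *)
Lemma enlarge_theta (A B : {fset nat}) :
    (forall y, y \in A -> theta C <= y%:Z) ->
  forall z, z \in enlarge C A (new_sums A B) -> 0 <= z /\ theta C <= z.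
Proof.
move=> Ath z /enlargeP[[y yA ->]|[e [c [eB cC ->]]]]; first by split=> //; exact: Ath.
have [s [t [sA tA ->]]] := new_sumsP eB.
have := theta_min cC; have := Ath s sA; have := Ath t tA.
by split; lia.
Qed.

Lemma run_theta k y : y \in Y k -> theta C <= y%:Z.
Proof.
elim: k y => [|k IH] y /=; first by rewrite !inE => /andP[/X_theta].
rewrite !inE => /andP[/imfsetP[z /= /(enlarge_theta IH)[z0 zth] ->] _].
by rewrite gez0_abs.
Qed.

Lemma run_enlarge k z : z \in enlarge C (Y k) (E k) ->
  exists2 n, n \in Z k & z = n%:Z.
Proof.
move=> zE; have [z0 _] := enlarge_theta (@run_theta k) zE.
by exists (absz z); [apply/imfsetP; exists z|rewrite gez0_abs].
Qed.

Lemma run_next k : Defs.next C (Y k) (D k) (Y k.+1).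
Proof.
exists (Z k); split; last exact: msg_fsetE.
apply/fsetP => z; apply/imfsetP/idP => [[n /= /imfsetP[w /= wE ->] ->]|zE].
- by have [w0 _] := enlarge_theta (@run_theta k) wE; rewrite gez0_abs.
- by have [n nZ ->] := run_enlarge zE; exists n.
Qed.

Lemma run_genS k : G k.+1 = monoid_gen [set` Z k].
Proof. exact: monoid_gen_msg_fset. Qed.

(** This recovers [Y k] from its monoid, so that a stationary chain of monoids forces a repeated
    [Y]. *)
Lemma run_msg k : msg (G k) = [set` Y k].
Proof. by case: k => [|k] /=; rewrite monoid_gen_msg_fset msg_fsetE. Qed.

Lemma run_gen_incr k : G k `<=` G k.+1.
Proof.
rewrite run_genS; apply: monoid_gen_sub => [|y /= yY].
  exact: monoid_gen_submonoid.
apply: sub_monoid_gen => /=; apply/imfsetP; exists y%:Z => //=.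
by apply/enlargeP; left; exists y.
Qed.

Lemma run_gen_new_sums k e c :
  e \in E k -> c \in C -> (Posz @` G k.+1) (e%:Z + c).
Proof.
move=> eE cC; have [|n nZ ->] := @run_enlarge k (e%:Z + c).
  by apply/enlargeP; right; exists e, c.
by exists n => //; rewrite run_genS; exact: sub_monoid_gen.
Qed.

Lemma run_gen_done k e c : e \in D k -> c \in C -> (Posz @` G k) (e%:Z + c).
Proof.
elim: k => [|k IH] //.
rewrite /= in_fsetU => /orP[eD|eE] cC; last exact: run_gen_new_sums.
by have [n Gn <-] := IH eD cC; exists n => //; exact: run_gen_incr.
Qed.

Lemma run_sub_gen k : [set` X] `<=` G k.
Proof.
elim: k => [|k IH]; last exact: subset_trans IH (@run_gen_incr k).
rewrite /= monoid_gen_msg_fset; exact: sub_monoid_gen.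
Qed.

(** * Correctness at a repetition, and termination *)

Lemma run_gen_sub_LC k : G k `<=` LC C [set` X].
Proof.
have [[sL LcC] XL _] := @LC_smallest C [set` X] X_theta.
elim: k => [|k IH]; first by rewrite /= monoid_gen_msg_fset; exact: monoid_gen_sub.
rewrite run_genS; apply: monoid_gen_sub => // _ /imfsetP[z /= zE ->].
suff [n Ln <-] : (Posz @` LC C [set` X]) z by [].
(* The incentive condition needs nonzero summands; elements of a [msg] are nonzero. *)
have YG y : y \in Y k -> (LC C [set` X] `\ 0%N) y.
  move=> yY; split; first by apply: IH; exact: sub_monoid_gen.
  have : msg (G k) y by rewrite run_msg.
  by case=> -[].
case/enlargeP: zE => [[y yY ->]|[e [c [eE cC ->]]]].
  by exists y => //; have [] := YG y yY.
have [s [t [sY tY ->]]] := new_sumsP eE.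
by rewrite PoszD; apply: LcC => //; exact: YG.
Qed.

Lemma run_stable_gen k : Y k.+1 = Y k -> G k = LC C [set` X].
Proof.
move=> stab; apply/seteqP; split; first exact: run_gen_sub_LC.
have [_ _ minL] := @LC_smallest C [set` X] X_theta.
apply: minL; last exact: run_sub_gen.
apply: monoid_gen_incentive => s t c sY tY cC; rewrite -PoszD.
have [stD|stD] := boolP ((s + t)%N \in D k); first exact: run_gen_done.
(* A sum not yet in [D k] is treated in round [k]; its shifts lie in [G k.+1], which is [G k] by
   stability. *)
rewrite -stab; apply: run_gen_new_sums => //.
by rewrite inE stD; apply/imfset2P; exists s => //; exists t.
Qed.

Lemma run_stabilizes m : m \in X -> (0 < m)%N -> exists k, Y k.+1 = Y k.
Proof.
move=> mX m0.
have [||||K KP] := @submonoid_chain_stationary (fun k => G k) m.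
- exact: m0.
- by move=> k; exact: monoid_gen_submonoid.
- by move=> k; exact: run_sub_gen.
- exact: run_gen_incr.
exists K; apply: set_fset_inj; rewrite -(run_msg K.+1) -(run_msg K); congr msg.
by apply/seteqP; split; [exact: KP|exact: run_gen_incr].
Qed.

(** Minimality of [k] ensures that every earlier round changes [Y], as [loop_again] demands. The
    induction is on the number [d] of rounds left before the return. *)
Lemma run_loop k : Y k.+1 = Y k -> (forall j, Y j.+1 = Y j -> (k <= j)%N) ->
  loop C (Y 0) fset0 (Y k).
Proof.
move=> stab kmin.
suff H d : (d <= k)%N -> loop C (Y (k - d)) (D (k - d)) (Y k).
  by have := H k (leqnn k); rewrite subnn.
elim: d => [_|d IH dk].
  by rewrite subn0; apply: loop_return; rewrite -{2}stab; exact: run_next.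
have kdE : (k - d = (k - d.+1).+1)%N by lia.
apply: (@loop_again _ _ _ (Y (k - d))).
- by rewrite kdE; exact: run_next.
- by rewrite kdE => /kmin; lia.
- by have := IH (ltnW dk); rewrite {2}kdE.
Qed.

End Run.

Theorem mainTheorem2 (C : {fset int}) (X : {fset nat})
  (hC : C != fset0) (hX : X != fset0)
  (hX_pos : forall x : nat, x \in X -> (0 < x)%N)
  (hX_theta : forall x : nat, x \in X -> theta C <= x%:Z) :
  exists R : {fset nat}, returns C X R /\ [set` R] = msg (LC C [set` X]).
Proof.
have /fset0Pn[m mX] := hX.
have exk : exists k, (run C X k.+1).1 == (run C X k).1.
  have [k /eqP stab] := @run_stabilizes C X m mX (hX_pos m mX).
  by exists k.
case: (ex_minnP exk) => k /eqP stab kmin.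
exists (run C X k).1; split.
  exists (run C X 0).1; split; first exact: msg_fsetE.
  by apply: run_loop => // j /eqP; exact: kmin.
by rewrite -(run_stable_gen hX_theta stab) run_msg.
Qed.
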